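(* Let $E$ be a field of characteristic different from $2$ and let $f\in E[X]$ be square-free with $\deg(f)\leq 2$. Then $f$ is square-reflexive.
   Context: For a commutative ring $R$ let $R^\times$ be its group of units and $R^{\times 2}=\{x^2\mid x\in R^\times\}$; an element of $R$ is square-free if it is not equal to $x^2y$ for any $x\in R\setminus R^\times$ and $y\in R$. For a nonzero $f\in E[X]$ put $E_f=E[X]/(f)$, let $\mathrm{N}_{E_f/E}:E_f\to E$ be the norm of this finite-dimensional $E$-algebra (determinant of multiplication) and let $\mathrm{lc}(f)$ be the leading coefficient of $f$. A square-free polynomial $f\in E[X]\setminus\{0\}$ is called square-reflexive if for every $\alpha\in E_f^\times$ with $\mathrm{N}_{E_f/E}(\alpha)\in E^{\times 2}\cup \mathrm{lc}(f)E^{\times 2}$ there exists a polynomial $g\in E[X]$ coprime to $f$ such that $g+(f)\in\alpha E_f^{\times 2}$ and $f+(g)\in E_g^{\times 2}$. *)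

(* Defs.v *)
From HB Require Import structures.
From mathcomp Require Import all_boot all_algebra.

Set Implicit Arguments.
Unset Strict Implicit.
Unset Printing Implicit Defensive.

Import GRing.Theory.
Local Open Scope ring_scope.

(* Units are defined over comPzRingType because E[X]/(f) is the zero ring when
   f is a nonzero constant, and MathComp's unitRingType excludes zero rings. *)
Definition is_unit (R : comPzRingType) (x : R) : Prop := exists y, x * y = 1.

Definition is_unit_square (R : comPzRingType) (x : R) : Prop :=
  exists2 u, is_unit u & x = u ^+ 2.

Definition square_free (R : comPzRingType) (z : R) : Prop :=
  ~ exists x y : R, ~ is_unit x /\ z = x ^+ 2 * y.

Lemma is_unitE (R : comUnitRingType) (x : R) :
  is_unit x <-> x \is a GRing.unit.
Proof.
split=> [[y xy1]|Ux]; last by exists x^-1; rewrite divrr.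
by apply/unitrPr; exists y.
Qed.

Lemma square_free_neq0 (E : fieldType) (f : {poly E}) :
  square_free f -> f != 0.
Proof.
move=> sqf; apply/eqP=> f0; apply: sqf; exists 0, 0; split.
  by case=> y /eqP; rewrite mul0r eq_sym oner_eq0.
by rewrite mulr0.
Qed.

(* The ring E[X]/(f), for f != 0, represented by the remainders modulo f.
   Unlike MathComp's {poly %/ f}, which replaces f by 'X unless f is monic and
   nonconstant, this is the quotient by (f) for every f != 0. (For f = 0 it is
   a junk zero ring.) *)
Definition quot_poly (E : fieldType) (f : {poly E}) : predArgType :=
  {poly_((size f).-1) E}.

HB.instance Definition _ (E : fieldType) (f : {poly E}) :=
  Vector.on (quot_poly f).

(* The residue class p + (f). *)
Definition residue (E : fieldType) (f p : {poly E}) : quot_poly f :=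
  npolyp (size f).-1 (p %% f).

Section QuotPoly.
Variables (E : fieldType) (f : {poly E}).
Implicit Types (p q : {poly E}) (x y z : quot_poly f).

Definition quot_poly_one : quot_poly f := residue f 1.
Definition quot_poly_mul x y : quot_poly f := residue f (polyn x * polyn y).

Lemma val_residue p : f != 0 -> polyn (residue f p) = p %% f.
Proof.
move=> f0; rewrite npolypK // -ltnS prednK ?ltn_modp //.
by rewrite lt0n size_poly_eq0.
Qed.

Lemma quot_poly_small x : f != 0 -> polyn x %% f = polyn x.
Proof.
move=> f0; rewrite modp_small // -[X in (_ < X)%N]prednK; last first.
  by rewrite lt0n size_poly_eq0.
by rewrite ltnS size_npoly.
Qed.

Lemma quot_poly_eq x y : (f != 0 -> polyn x = polyn y) -> x = y.
Proof.
have [f0 _|f0 /(_ isT) /val_inj //] := eqVneq f 0.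
apply: val_inj; apply: etrans (_ : _ = 0) (esym _); apply/eqP;
  by rewrite -size_poly_leq0 (leq_trans (size_npoly _)) // f0 size_poly0.
Qed.

Lemma quot_poly_mulA : associative quot_poly_mul.
Proof.
move=> x y z; apply: quot_poly_eq => f0.
rewrite /quot_poly_mul !val_residue //.
by rewrite modp_mul [X in _ = X %% f]mulrC modp_mul mulrCA mulrC mulrA
           [polyn z * _]mulrC -mulrA mulrC.
Qed.

Lemma quot_poly_mulC : commutative quot_poly_mul.
Proof. by move=> x y; rewrite /quot_poly_mul mulrC. Qed.

Lemma quot_poly_mul1 : left_id quot_poly_one quot_poly_mul.
Proof.
move=> x; apply: quot_poly_eq => f0; rewrite /quot_poly_mul !val_residue //.
by rewrite mulrC modp_mul mulr1 quot_poly_small.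
Qed.

Lemma quot_poly_mulD : left_distributive quot_poly_mul +%R.
Proof.
move=> x y z; apply: quot_poly_eq => f0.
have polynD u v : polyn (u + v : quot_poly f) = polyn u + polyn v by [].
by rewrite polynD /quot_poly_mul !val_residue // polynD mulrDl modpD.
Qed.

HB.instance Definition _ := GRing.Zmodule_isComPzRing.Build (quot_poly f)
  quot_poly_mulA quot_poly_mulC quot_poly_mul1 quot_poly_mulD.

Lemma residueK x : f != 0 -> residue f (polyn x) = x.
Proof.
by move=> f0; apply: val_inj; rewrite /= val_residue // quot_poly_small.
Qed.

Lemma residue_eq p q : f != 0 -> residue f p = residue f q <-> f %| p - q.
Proof.
move=> f0; split=> [/(congr1 (@polyn _ _))|].
  by rewrite !val_residue // /dvdp modpD modpN => ->; rewrite subrr.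
rewrite /dvdp modpD modpN subr_eq0 => /eqP pq.
by apply: quot_poly_eq => _; rewrite !val_residue.
Qed.

Lemma residueD p q : residue f (p + q) = residue f p + residue f q.
Proof.
apply: quot_poly_eq => f0; rewrite val_residue // modpD.
by rewrite -!val_residue.
Qed.

Lemma residueZ (a : E) p : residue f (a *: p) = a *: residue f p.
Proof.
apply: quot_poly_eq => f0; rewrite val_residue // modpZl.
by rewrite -val_residue.
Qed.

Lemma residue1 : residue f 1 = 1. Proof. by []. Qed.

Lemma residueM p q : residue f (p * q) = residue f p * residue f q.
Proof.
apply: quot_poly_eq => f0; rewrite [RHS]val_residue // !val_residue //.
by rewrite modp_mul [in RHS]mulrC modp_mul mulrC.
Qed.

Lemma quot_poly_mulZ (c : E) x y : x * (c *: y) = c *: (x * y).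
Proof.
apply: quot_poly_eq => f0.
have polynZ u : polyn (c *: u : quot_poly f) = c *: polyn u by [].
by rewrite polynZ !val_residue // polynZ -scalerAr modpZl.
Qed.

(* Row i holds the coordinates of a * 'X^i in the basis 1, 'X, .., 'X^(n-1) of
   E[X]/(f), with n = deg f. *)
Definition mul_quot_mx (a : quot_poly f) : 'M[E]_((size f).-1) :=
  \matrix_(i, j) (polyn (a * residue f 'X^i))`_j.

Definition quot_norm (a : quot_poly f) : E := \det (mul_quot_mx a).

Lemma mul_quot_mxE a x : f != 0 ->
  npoly_rV (a * x : quot_poly f) = npoly_rV x *m mul_quot_mx a.
Proof.
move=> f0; apply/rowP=> j; rewrite !mxE.
have -> : a * x = \sum_(i < (size f).-1) (polyn x)`_i *: (a * residue f 'X^i).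
  rewrite -[in LHS](residueK x f0) [in LHS](_ : polyn x =
    \sum_(i < (size f).-1) (polyn x)`_i *: 'X^i); last first.
    apply/polyP=> k; rewrite -poly_def coef_poly.
    by case: ltnP => // le_k; rewrite nth_default // (leq_trans (size_npoly x)).
  rewrite (big_morph _ residueD (_ : residue f 0 = 0)); last first.
    by rewrite -[0 in LHS](scale0r 0) residueZ scale0r.
  rewrite mulr_sumr; apply: eq_bigr => i _.
  by rewrite residueZ quot_poly_mulZ.
rewrite (_ : (polyn _)`_j =
  \sum_(i < (size f).-1) (polyn x)`_i * (polyn (a * residue f 'X^i))`_j).
  by apply: eq_bigr => i _; rewrite !mxE.
rewrite coefn_sum; apply: eq_bigr => i _.
by rewrite -coefZ.
Qed.

End QuotPoly.

Definition square_reflexive (E : fieldType) (f : {poly E}) : Prop :=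
  [/\ f != 0, square_free f &
      forall a : quot_poly f,
        is_unit a ->
        (exists2 c : E, is_unit_square c &
           quot_norm a = c \/ quot_norm a = lead_coef f * c) ->
        exists g : {poly E},
          [/\ g != 0, coprimep g f,
              exists2 s : quot_poly f, is_unit_square s & residue f g = a * s &
              is_unit_square (residue g f)]].

(* Main.v *)
Require Import Defs.
From HB Require Import structures.
From mathcomp Require Import all_boot all_algebra.
From mathcomp Require Import ring.

Set Implicit Arguments.
Unset Strict Implicit.
Unset Printing Implicit Defensive.

Import GRing.Theory.
Local Open Scope ring_scope.

(** Constants are easy witnesses: for a nonzero constant g the quotient E[X]/(g)
    is the zero ring, in which every element is the square of a unit, so g is a
    witness for every class in g times the squares of units
    ([constant_witness]).  This settles the classes of constants
    ([constant_class_witness]), hence every f of degree at most 1.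

    Let f be quadratic with leading coefficient c, and a the class of
    p = p0 + p1 X with p1 nonzero.  Write r = - p0 / p1 for the root of p.
    Then N(a) = p1^2 f(r) / c, by the explicit norm [quot_norm_quadratic].

    If N(a) is c times a nonzero square, then f(r) is a nonzero square; as f is
    congruent to f(r) modulo p, the polynomial g = p itself is a witness
    ([lead_coef_norm_witness]).

    If N(a) = n^2 with n nonzero, then a is a constant times a square.  With T
    the trace of a, the characteristic equation a^2 - T a + n^2 = 0
    ([quadratic_char_equation]) reads (a + n)^2 = (T + 2 n) a.  The sign of n is
    free, and since 2 is invertible T + 2 n and T - 2 n are not both zero, so it
    can be chosen to make e = T + 2 n nonzero; then e = a ((a + n) / a)^2 and
    the constant g = e is a witness ([square_norm_witness]). *)

(** A square root of e / a is (a + n) / a.  For e = T + 2 n the hypothesis is the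
    characteristic equation of a class a of trace T and norm n^2. *)
Lemma unit_square_quotient (R : comPzRingType) (a n e : R) :
    is_unit a -> is_unit e -> (a + n) ^+ 2 = e * a ->
  exists2 s, is_unit_square s & e = a * s.
Proof.
move=> [b ab] [d ed] sq_an; set u := (a + n) * b.
have e_au : e = a * u ^+ 2.
  have -> : a * u ^+ 2 = a * b * b * (a + n) ^+ 2 by rewrite /u; ring.
  by rewrite ab mul1r sq_an mulrCA [b * a]mulrC ab mulr1.
exists (u ^+ 2) => //; exists u => //; exists (u * a * d).
by rewrite -ed [in RHS]e_au; ring.
Qed.

Lemma eqp_polyC1 (E : fieldType) (e : E) : e != 0 -> e%:P %= 1.
Proof. by move=> e0; rewrite -size_poly_eq1 size_polyC e0. Qed.

Lemma coprimep_polyC (E : fieldType) (e : E) p : e != 0 -> coprimep e%:P p.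
Proof. by move=> /eqp_polyC1 e1; rewrite (eqp_coprimepl _ e1) coprime1p. Qed.

Lemma is_unit_square1 (R : comPzRingType) : is_unit_square (1 : R).
Proof. by exists 1; [exists 1; rewrite mulr1 | rewrite expr1n]. Qed.

Section Residue.
Variables (E : fieldType) (f : {poly E}).
Hypothesis f0 : f != 0.
Implicit Types p h : {poly E}.

Lemma is_unit_residueP p : is_unit (residue f p) <-> coprimep p f.
Proof.
split=> [[y] | /Bezout_eq1_coprimepP[[u v] /= uv1]].
  rewrite -(residueK y f0) -residueM -residue1 => /residue_eq - /(_ f0).
  move=> /dvdpP[q Dq]; apply/Bezout_eq1_coprimepP; exists (polyn y, - q) => /=.
  by rewrite mulNr -Dq; ring.
exists (residue f u); rewrite -residueM -residue1; apply/residue_eq => //.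
apply/dvdpP; exists (- v); rewrite -uv1; ring.
Qed.

Lemma unit_square_residue p h :
  coprimep h f -> f %| p - h ^+ 2 -> is_unit_square (residue f p).
Proof.
move=> /is_unit_residueP Uh /residue_eq - /(_ f0) ->.
by exists (residue f h); rewrite // !expr2 residueM.
Qed.

End Residue.

Definition reflexivity_witness (E : fieldType) (f : {poly E}) (a : quot_poly f)
    (g : {poly E}) : Prop :=
  [/\ g != 0, coprimep g f,
      exists2 s : quot_poly f, is_unit_square s & residue f g = a * s &
      is_unit_square (residue g f)].

(** For a nonzero constant g the ring E[X]/(g) is zero, so the condition that f
    be the square of a unit in it is vacuous. *)
Lemma constant_witness (E : fieldType) (f : {poly E}) (a : quot_poly f) (e : E) :
    e != 0 ->
    (exists2 s, is_unit_square s & residue f e%:P = a * s) ->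
  reflexivity_witness a e%:P.
Proof.
move=> e0 e_as; split; rewrite ?polyC_eq0 ?coprimep_polyC //.
apply: (@unit_square_residue _ _ _ _ 1); rewrite ?polyC_eq0 ?coprime1p //.
by rewrite (eqp_dvdl _ (eqp_polyC1 e0)) dvd1p.
Qed.

Lemma constant_class_witness (E : fieldType) (f : {poly E}) (a : quot_poly f) :
    f != 0 -> is_unit a -> (size (polyn a) <= 1)%N ->
  exists g, reflexivity_witness a g.
Proof.
move=> f0 Ua /size1_polyC a_const; set c := (polyn a)`_0 in a_const.
have [c0 | c0] := eqVneq c 0; last first.
  exists c%:P; apply: constant_witness => //.
  by exists 1; [exact: is_unit_square1 | rewrite mulr1 -a_const residueK].
(* The class 0 is a unit only if E[X]/(f) is the zero ring. *)
have a0 : a = 0 by apply: val_inj; rewrite /= a_const c0.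
case: Ua => y; rewrite a0 mul0r => zero_one.
exists 1%:P; apply: constant_witness; rewrite ?oner_eq0 //.
by exists 1; [exact: is_unit_square1 | rewrite residue1 mul0r -zero_one].
Qed.

Lemma det_matrix2 (R : comNzRingType) n (F : nat -> nat -> R) :
  n = 2 -> \det (\matrix_(i < n, j < n) F i j) = F 0 0 * F 1 1 - F 0 1 * F 1 0.
Proof.
move=> ->; rewrite (expand_det_row _ ord0) !big_ord_recl big_ord0 /cofactor.
by rewrite !det_mx11 !mxE /= /bump /=; ring.
Qed.

Lemma size_linear_lt (R : nzRingType) (b d : R) :
  (size (b *: 'X + d%:P)%R < 3)%N.
Proof.
rewrite (leq_ltn_trans (size_polyD _ _)) // gtn_max.
rewrite (leq_ltn_trans (size_scale_leq _ _)) ?size_polyX //.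
by rewrite (leq_ltn_trans (size_polyC_leq1 _)).
Qed.

Section Quadratic.
Variables (E : fieldType) (c u v p0 p1 : E).
Let f : {poly E} := c%:P * ('X^2 + u%:P * 'X + v%:P).
Hypothesis c0 : c != 0.
Variable a : quot_poly f.
Hypothesis Da : polyn a = p0%:P + p1%:P * 'X.

Let size_f : size f = 3.
Proof.
rewrite /f mul_polyC size_scale // -addrA size_polyDl ?size_polyXn //.
by rewrite mul_polyC (size_linear_lt u v).
Qed.

Let f0 : f != 0. Proof. by rewrite -size_poly_eq0 size_f. Qed.

(** Since X^2 = - u X - v modulo f, the second row of the matrix of
    multiplication by p0 + p1 X is (- v p1, p0 - u p1). *)
Lemma quot_norm_quadratic : quot_norm a = p0 ^+ 2 - u * p0 * p1 + v * p1 ^+ 2.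
Proof.
rewrite /quot_norm /mul_quot_mx.
rewrite (@det_matrix2 _ _ (fun i j => (polyn (a * residue f 'X^i))`_j)); last first.
  by rewrite size_f.
have -> : a * residue f 'X^0 = a by rewrite expr0 residue1 mulr1.
have -> : polyn (a * residue f 'X^1) = (- v * p1)%:P + (p0 - u * p1)%:P * 'X.
  rewrite -{1}(residueK a f0) -residueM val_residue // Da expr1.
  have -> : (p0%:P + p1%:P * 'X) * 'X =
      (p1 / c)%:P * f + ((- v * p1)%:P + (p0 - u * p1)%:P * 'X).
    have -> : (p1 / c)%:P * f = p1%:P * ('X^2 + u%:P * 'X + v%:P).
      by rewrite mulrA -polyCM divfK.
    by rewrite !(polyCM, polyCD, polyCN); ring.
  rewrite modp_addl_mul_small // size_f addrC mul_polyC.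
  by rewrite size_linear_lt.
by rewrite Da !(coefD, coefC, coefCM, coefX) /=; ring.
Qed.

(** The Cayley-Hamilton identity for a, whose trace is 2 p0 - u p1; its two
    sides, as polynomials, differ by p1^2 (X^2 + u X + v), a multiple of f. *)
Lemma quadratic_char_equation :
  a ^+ 2 + residue f (quot_norm a)%:P = residue f (2 * p0 - u * p1)%:P * a.
Proof.
rewrite -(residueK a f0) expr2 -!residueM -residueD residueK //.
apply/residue_eq => //; apply/dvdpP; exists (p1 ^+ 2 / c)%:P.
have -> : (p1 ^+ 2 / c)%:P * f = p1%:P ^+ 2 * ('X^2 + u%:P * 'X + v%:P).
  by rewrite mulrA -polyCM divfK // rmorphXn.
by rewrite quot_norm_quadratic Da !(polyCM, polyCD, polyCN, rmorphXn) /=; ring.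
Qed.

Lemma square_norm_witness n :
    (2 : E) != 0 -> is_unit a -> n != 0 -> quot_norm a = n ^+ 2 ->
  exists g, reflexivity_witness a g.
Proof.
move=> two0 Ua n0 Na; set t := 2 * p0 - u * p1.
(* t + 2 n and t - 2 n differ by 4 n, which is nonzero. *)
have [m [Dm e0]] : exists m, m ^+ 2 = n ^+ 2 /\ t + 2 * m != 0.
  have [tn0 | tn0] := eqVneq (t + 2 * n) 0; last by exists n.
  exists (- n); split; first by rewrite sqrrN.
  have -> : t + 2 * - n = - (2 * (2 * n)) by rewrite -[RHS]addr0 -tn0; ring.
  by rewrite oppr_eq0 !mulf_neq0.
exists (t + 2 * m)%:P; apply: constant_witness => //.
apply: (@unit_square_quotient _ _ (residue f m%:P)) => //.
  by apply/is_unit_residueP; rewrite ?coprimep_polyC.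
have -> : (a + residue f m%:P) ^+ 2 =
    a ^+ 2 + residue f m%:P ^+ 2 + residue f m%:P * a *+ 2 by ring.
rewrite [residue f m%:P ^+ 2]expr2 -residueM -polyCM -expr2 Dm -Na.
rewrite quadratic_char_equation -/t [in RHS]polyCD residueD mulrDl.
congr (_ + _).
by rewrite mulr_natl polyCMn !mulr2n residueD mulrDl.
Qed.

(** Here f(r) = c N(a) / p1^2 for the root r = - p0 / p1 of the linear
    polynomial polyn a, and f is congruent to f(r) modulo it. *)
Lemma lead_coef_norm_witness n :
    p1 != 0 -> is_unit a -> n != 0 -> quot_norm a = c * n ^+ 2 ->
  exists g, reflexivity_witness a g.
Proof.
move=> p1_0 Ua n0 Na; exists (polyn a).
have a0 : polyn a != 0.
  apply: contraNneq p1_0 => /(congr1 (fun p : {poly E} => p`_1)).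
  by rewrite Da coefD coefC coefCM coefX /= coef0 add0r mulr1 => ->.
split=> //; first by rewrite -is_unit_residueP // residueK.
  by exists 1; [exact: is_unit_square1 | rewrite residueK // mulr1].
have h0 : c * n / p1 != 0 by rewrite !mulf_neq0 ?invr_eq0.
apply: (@unit_square_residue _ _ _ _ (c * n / p1)%:P);
  rewrite ?coprimep_polyC //.
have -> : (c * n / p1)%:P ^+ 2 = (c / p1 ^+ 2 * quot_norm a)%:P.
  by rewrite -rmorphXn Na /=; congr _%:P; field.
rewrite quot_norm_quadratic Da /f; apply/dvdpP.
(* With w = p0 / p1, f - f(-w) = c (X + w) (X - w + u) and p = p1 (X + w). *)
set k := c / p1; set w := p0 / p1; exists (k%:P * ('X + (u - w)%:P)).
have -> : p0 = w * p1 by rewrite divfK.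
have -> : c / p1 ^+ 2 = k / p1 by rewrite /k; field.
have -> : c = k * p1 by rewrite divfK.
have -> : k / p1 * ((w * p1) ^+ 2 - u * (w * p1) * p1 + v * p1 ^+ 2) =
    k * p1 * (w ^+ 2 - u * w + v) by field.
by rewrite !(polyCM, polyCD, polyCN, rmorphXn) /=; ring.
Qed.

End Quadratic.

Theorem proposition4p1 (E : fieldType) (hE : 2%N \notin [pchar E])
    (f : {poly E}) (hf : square_free f) (hdeg : (size f <= 3)%N) :
  square_reflexive f.
Proof.
have f0 := square_free_neq0 hf; split=> // a Ua [_ [n /is_unitE Un ->] Na].
have n0 : n != 0 by rewrite -unitfE.
have [size_a | size_a] := leqP (size (polyn a)) 1.
  exact: constant_class_witness.
have size_f : size f = 3.
  apply/eqP; rewrite eqn_leq hdeg; have := leq_trans size_a (size_npoly a).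
  by rewrite -subn1 ltn_subRL.
set c := lead_coef f in Na; have c0 : c != 0 by rewrite lead_coef_eq0.
have Df : f = c%:P * ('X^2 + (f`_1 / c)%:P * 'X + (f`_0 / c)%:P).
  rewrite mul_polyC; apply/polyP=> i.
  rewrite coefZ !coefD coefCM coefXn coefX coefC.
  case: i => [|[|[|i]]] /=; rewrite ?(mulr0, mulr1, addr0, add0r).
  - by rewrite mulrC divfK.
  - by rewrite mulrC divfK.
  - by rewrite /c /lead_coef size_f.
  - by rewrite nth_default ?size_f.
have Da : polyn a = ((polyn a)`_0)%:P + ((polyn a)`_1)%:P * 'X.
  apply/polyP=> i; rewrite coefD coefC coefCM coefX.
  case: i => [|[|i]] /=; rewrite ?mulr0 ?mulr1 ?addr0 ?add0r //.
  by rewrite nth_default // (leq_trans (size_npoly a)) ?size_f.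
have p1_0 : (polyn a)`_1 != 0.
  apply: contraTneq size_a => p1_0; rewrite -leqNgt Da p1_0 mul0r addr0.
  by rewrite size_polyC; case: (_ != 0).
(* Replacing f by its expression in c, u and v inside the type of a. *)
move: (f`_1 / c) (f`_0 / c) Df c0 Na => u v; move: c => {hf hdeg size_f}c Df.
move: a Ua size_a Da p1_0 f0; rewrite Df => a Ua _ Da p1_0 _ c0 [] Na.
  by apply: (square_norm_witness c0 Da _ Ua n0 Na).
by apply: (lead_coef_norm_witness c0 Da p1_0 Ua n0 Na).
Qed.
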